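(* Let $\mathbf x=\{\mathbf x_k\}_{k=0}^N$ and $\mathbf y=\{\mathbf y_k\}_{k=0}^N$ be two discrete series, $\mathbf x_k=(x_k^1,\ldots,x_k^{s+1})$, $\mathbf y_k=(y_k^1,\ldots,y_k^{s+1})$ with $x_k^i,y_k^i\in\mathbb R^d$, satisfying the continuity conditions $x_{k-1}^{s+1}=x_k^1$, $y_{k-1}^{s+1}=y_k^1$ for $k=1,\ldots,N$, and such that $x_N^i=y_N^i=0$ for $i=2,\ldots,s+1$. Then the equations $$D_{s+1}L_{\mathrm{dis}}(\mathbf x_{k-1})+D_1L_{\mathrm{dis}}(\mathbf x_k)-\rho h\Big(b_1[\mathcal D_-^{2\alpha}\mathbf x_k]^1+b_{s+1}[\mathcal D_-^{2\alpha}\mathbf x_{k-1}]^{s+1}\Big)=0,\quad k=1,\ldots,N-1,$$ $$D_iL_{\mathrm{dis}}(\mathbf x_k)-\rho h\,b_i[\mathcal D_-^{2\alpha}\mathbf x_k]^i=0,\quad k=0,\ldots,N-1,\ i=2,\ldots,s,$$ $$D_{s+1}L_{\mathrm{dis}}(\mathbf y_{k-1})+D_1L_{\mathrm{dis}}(\mathbf y_k)-\rho h\Big([\mathcal D_+^{2\alpha}B\mathbf y_k]^1+[\mathcal D_+^{2\alpha}B\mathbf y_{k-1}]^{s+1}\Big)=0,\quad k=1,\ldots,N-1,$$ $$D_iL_{\mathrm{dis}}(\mathbf y_k)-\rho h\,[\mathcal D_+^{2\alpha}B\mathbf y_k]^i=0,\quad k=0,\ldots,N-1,\ i=2,\ldots,s,$$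 are sufficient conditions for $(\mathbf x,\mathbf y)$ to be an extremal of the discrete action $\mathcal L_{\mathrm{dis}}$ under restricted variations; that is, if all these equations hold, then $$\frac{d}{d\epsilon}\Big|_{\epsilon=0}\mathcal L_{\mathrm{dis}}\big(\{\mathbf x_k+\epsilon\,\delta\mathbf x_k\}_{k=0}^N,\{\mathbf y_k+\epsilon\,\delta\mathbf x_k\}_{k=0}^N\big)=0$$ for every admissible restricted variation $\{\delta\mathbf x_k\}_{k=0}^N$.
   Context: Setting: $d,N,s\ge 1$ are integers, $T>0$, $h=T/N$, $t_k=kh$, $\alpha>0$, $\rho>0$, $L:\mathbb R^d\times\mathbb R^d\to\mathbb R$, $(q,\dot q)\mapsto L(q,\dot q)$, is a $C^2$ Lagrangian. Put $r=s+1$ and let $(A,\mathbf b,\mathbf c)$ be the $r$-stage Lobatto IIIC Runge-Kutta method: $0=c_1<\dots<c_r=1$ are the zeros of $\frac{d^{r-2}}{dx^{r-2}}\big(x^{r-1}(x-1)^{r-1}\big)$, $b_1,\dots,b_r$ are the interpolatory quadrature weights on $[0,1]$ at these nodes, and $A=(a_{ij})\in\mathbb R^{r\times r}$ is determined by $a_{i1}=b_1$ and $\sum_j a_{ij}c_j^{l-1}=c_i^l/l$ for $l=1,\dots,r-1$. ($A$ is invertible.) Let $B=\mathrm{diag}(b_1,\dots,b_r)$ and $\mathbb 1=(1,\dots,1)^\top\in\mathbb R^r$. Discrete fractional derivatives (Runge-Kutta convolution quadrature): with $$\gamma(z)=\Big(A+\tfrac{z}{1-z}\mathbb 1\mathbf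 b^\top\Big)^{-1},$$ for $\theta>0$ the weights $V_n^{(\theta)}\in\mathbb R^{r\times r}$ are defined by the power series $\big(\gamma(z)/h\big)^{\theta}=\sum_{n\ge0}V_n^{(\theta)}z^n$ near $z=0$ (principal-branch matrix power). For a series $\{\mathbf f_k\}_{k=0}^N$ with $\mathbf f_k=(f_k^1,\dots,f_k^r)\in(\mathbb R^d)^r\cong\mathbb R^{r\times d}$, $$\mathcal D_-^{\theta}\mathbf f_k=\sum_{n=0}^kV_{k-n}^{(\theta)}\mathbf f_n,\qquad \mathcal D_+^{\theta}\mathbf f_k=\sum_{n=0}^{N-k}\big(V_n^{(\theta)}\big)^\top\mathbf f_{k+n}.$$ Matrices act on the stage index and componentwise in $\mathbb R^d$. $[\cdot]^i$ denotes the $i$-th row ($i$-th stage). $B\mathbf y$ is the series with $(B\mathbf y_k)^i=b_iy_k^i$, and $\mathcal D_+^{\theta}B\mathbf y_k$ denotes $\mathcal D_+^\theta$ applied to the series $B\mathbf y$, at index $k$. Discrete Lagrangian: $x_k^i$ represents the value of the trajectory at $t_k+c_ih$. With $\ell_1,\dots,\ell_r$ the Lagrange polynomials of degree $s$ at the nodes $c_1,\dots,c_r$, set $x_{\mathrm{dis}}(t;k)=\sum_{\nu=1}^{s+1}x_k^\nu\ell_\nu((t-t_k)/h)$ on $[t_k,t_{k+1}]$ and $$L_{\mathrm{dis}}(\mathbf x_k)=L_{\mathrm{dis}}(x_k^1,\dots,x_k^{s+1})=h\sum_{i=1}^rb_i\,L\big(x_{\mathrm{dis}}(t_k+c_ih;k),\dot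 x_{\mathrm{dis}}(t_k+c_ih;k)\big),$$ and similarly $L_{\mathrm{dis}}(\mathbf y_k)$. $D_iL_{\mathrm{dis}}$ is the partial derivative with respect to the $i$-th argument, $i=1,\dots,s+1$. Discrete action: $$\mathcal L_{\mathrm{dis}}(\mathbf x,\mathbf y)=\sum_{k=0}^{N-1}\big[L_{\mathrm{dis}}(\mathbf x_k)+L_{\mathrm{dis}}(\mathbf y_k)\big]-\rho h\sum_{k=0}^N\big\langle\mathcal D_+^\alpha B\mathbf y_k,\ \mathcal D_-^\alpha\mathbf x_k\big\rangle,$$ where $\langle\cdot,\cdot\rangle$ is the standard inner product on $\mathbb R^{r\times d}$. Admissible restricted variations: both series are varied by the same $\{\delta\mathbf x_k\}_{k=0}^N$, $\delta\mathbf x_k=(\delta x_k^1,\dots,\delta x_k^{s+1})$, $\delta x_k^i\in\mathbb R^d$ (i.e. $\delta\mathbf y_k=\delta\mathbf x_k$), with $\delta x_{k-1}^{s+1}=\delta x_k^1$ for $k=1,\dots,N$, $\delta x_0^1=0$, $\delta x_{N-1}^{s+1}=\delta x_N^1=0$, and $\delta\mathbf x_N=0$; otherwise arbitrary. *)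

(* Defs.v *)
From HB Require Import structures.
From mathcomp Require Export all_boot all_order all_algebra.
From mathcomp Require Export all_classical all_reals all_analysis.
From mathcomp Require Import complex.

Set Implicit Arguments.
Unset Strict Implicit.
Unset Printing Implicit Defensive.

Import Order.TTheory GRing.Theory Num.Theory.
Export numFieldNormedType.Exports.

Local Open Scope classical_set_scope.
Local Open Scope ring_scope.

(* Functions of class C^n.  On a finite-dimensional V, f is C^(n+1) iff it is
   (Frechet) differentiable and x |-> 'd f x v is C^n for every direction v. *)
Fixpoint is_Cn (R : realType) (V : normedModType R) (n : nat) (f : V -> R)
    : Prop :=
  if n is m.+1 then
    (forall x, differentiable f x) /\ (forall v, is_Cn m ('D_v f))
  else continuous f.

(* Row vector of the partial derivatives of F along the coordinates of the
   i-th row, i.e. D_i F with F seen as a function of its r rows in R^d. *)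
Definition row_partial (R : realType) (r d : nat) (i : 'I_r)
    (F : 'M[R]_(r, d) -> R) (X : 'M[R]_(r, d)) : 'rV[R]_d :=
  \row_j 'D_(delta_mx i j) F X.

Section MatrixPower.
Variables (R : realType) (n : nat).
Implicit Types M X : 'M[R]_n.

Definition expm X : 'M[R]_n :=
  limn (series (fun k => k`!%:R^-1 *: X ^+ k)).

(* Whenever a real matrix has no eigenvalue in ]-oo, 0], it has exactly one
   complex logarithm with spectrum in the strip |Im| < pi, and that logarithm
   is real; otherwise it has none. *)
Definition is_principal_log M X : Prop :=
  expm X = M /\
  forall l : R[i], eigenvalue (map_mx (real_complex R) X) l ->
    `|complex.Im l| < pi.

Definition logm M : 'M[R]_n := xget 0 [set X | is_principal_log M X].

Definition powm M (theta : R) : 'M[R]_n := expm (theta *: logm M).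

End MatrixPower.

Definition lagrange_pol (R : realType) (r : nat) (c : 'rV[R]_r) (i : 'I_r)
    : {poly R} :=
  \prod_(j < r | j != i) ((c 0 i - c 0 j)^-1 *: ('X - (c 0 j)%:P)).

(* Lobatto IIIC tableau with s.+1 stages; stages are numbered from 0. *)
Record lobattoIIIC (R : realType) (s : nat) (A : 'M[R]_s.+1)
    (b c : 'rV[R]_s.+1) : Prop := LobattoIIIC {
  lobatto_c_first : c 0 ord0 = 0;
  lobatto_c_last : c 0 ord_max = 1;
  lobatto_c_lt : forall i j : 'I_s.+1, (i < j)%N -> c 0 i < c 0 j;
  lobatto_c_zeros : forall x : R,
    root (('X ^+ s * ('X - 1) ^+ s)^`(s.-1)) x <-> exists i, x = c 0 i;
  lobatto_b : forall i,
    b 0 i = \int[@lebesgue_measure R]_(x in `[0%R, 1%R]) (lagrange_pol c i).[x];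
  lobatto_A_first : forall i, A i ord0 = b 0 ord0;
  lobatto_A_order : forall (i : 'I_s.+1) (l : nat), (1 <= l <= s)%N ->
    \sum_j A i j * c 0 j ^+ l.-1 = c 0 i ^+ l / l%:R
}.

Section ConvolutionQuadrature.
Variables (R : realType) (r : nat).

Definition rk_gamma (A : 'M[R]_r) (b : 'rV[R]_r) (z : R) : 'M[R]_r :=
  invmx (A + (z / (1 - z)) *: ((const_mx 1 : 'cV[R]_r) *m b)).

(* (gamma(z) / h) ^ theta = \sum_n V_n z ^ n near z = 0. The coefficients V_n
   being real, real z determine them. *)
Definition is_cq_weights (A : 'M[R]_r) (b : 'rV[R]_r) (h theta : R)
    (V : nat -> 'M[R]_r) : Prop :=
  \forall z \near (0 : R),
    series (fun n => z ^+ n *: V n) @ \oo --> powm (h^-1 *: rk_gamma A b z) theta.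

Variable d : nat.
Implicit Types f : nat -> 'M[R]_(r, d).

(* A series f_0, ..., f_N is a function on nat of which only the values at
   0, ..., N are used. *)
Definition frac_minus (V : nat -> 'M[R]_r) f (k : nat) : 'M[R]_(r, d) :=
  \sum_(n < k.+1) V (k - n)%N *m f n.

Definition frac_plus (V : nat -> 'M[R]_r) (N : nat) f (k : nat)
    : 'M[R]_(r, d) :=
  \sum_(n < (N - k).+1) (V n)^T *m f (k + n)%N.

Definition weighted (b : 'rV[R]_r) f (k : nat) : 'M[R]_(r, d) :=
  diag_mx b *m f k.

Definition inner (X Y : 'M[R]_(r, d)) : R := \sum_i \sum_j X i j * Y i j.

End ConvolutionQuadrature.

Section DiscreteLagrangian.
Variables (R : realType) (d r : nat) (b c : 'rV[R]_r) (h : R).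
Variable L : 'rV[R]_d * 'rV[R]_d -> R.

Definition x_dis (k : nat) (X : 'M[R]_(r, d)) (t : R) : 'rV[R]_d :=
  \sum_nu (lagrange_pol c nu).[(t - k%:R * h) / h] *: row nu X.

(* x_dis is extended polynomially beyond [t_k, t_(k+1)], which gives the
   one-sided derivatives at the end points. *)
Definition L_dis (k : nat) (X : 'M[R]_(r, d)) : R :=
  h * \sum_i b 0 i * L (x_dis k X (k%:R * h + c 0 i * h),
                        derive1 (x_dis k X) (k%:R * h + c 0 i * h)).

Definition action (N : nat) (rho : R) (Valpha : nat -> 'M[R]_r)
    (x y : nat -> 'M[R]_(r, d)) : R :=
  \sum_(k < N) (L_dis k (x k) + L_dis k (y k))
  - rho * h * \sum_(k < N.+1)
      inner (frac_plus Valpha N (weighted b y) k) (frac_minus Valpha x k).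

End DiscreteLagrangian.

Section Series.
Variables (R : realType) (d s N : nat).
Implicit Types x dx : nat -> 'M[R]_(s.+1, d).

Definition continuous_series x : Prop :=
  forall k, (1 <= k <= N)%N -> row ord_max (x k.-1) = row ord0 (x k).

Definition admissible_variation dx : Prop :=
  [/\ continuous_series dx,
      row ord0 (dx 0%N) = 0,
      row ord_max (dx N.-1) = 0,
      row ord0 (dx N) = 0 &
      dx N = 0].

End Series.

(* Main.v *)
Require Import Defs.

(* The map D_+ is the adjoint of D_- for the pairing summed over k, and the
   weights satisfy V^(alpha) * V^(alpha) = V^(2 alpha) (discrete convolution),
   because M^(2 alpha) = M^alpha M^alpha and a power series is determined by its
   values near 0.  The fractional part of the action is therefore the bilinear
   form sum_k <B y_k, D_-^(2 alpha) x_k>, whose derivative along (dx, dx) is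
   sum_k <D_+^(2 alpha) B y_k + B D_-^(2 alpha) x_k, dx_k>.  Together with the
   gradients of L_dis the first variation becomes sum_k <G_k, dx_k>; inner rows
   of G_k vanish, and since the last row of dx_(k-1) is the first row of dx_k,
   the remaining terms pair up into the node equations. *)

Set Implicit Arguments.
Unset Strict Implicit.
Unset Printing Implicit Defensive.

Import Order.TTheory GRing.Theory Num.Theory.
Import numFieldNormedType.Exports.

Local Open Scope classical_set_scope.
Local Open Scope ring_scope.

(** * Discrete convolution and Cauchy products of real series *)

Definition conv (A : pzRingType) (a b : nat -> A) (n : nat) : A :=
  \sum_(k < n.+1) a (n - k)%N * b k.

Lemma series_ord (V : zmodType) (u : V^nat) (n : nat) :
  series u n = \sum_(k < n) u k.
Proof. by rewrite seriesEord. Qed.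

(** Sums the products [a i * b k] over the triangle i + k < n column by column. In this shape the
    partial sums compare with the square [series a n * series b n]. *)
Lemma series_conv (A : pzRingType) (a b : nat -> A) (n : nat) :
  series (conv a b) n = \sum_(k < n) series a (n - k)%N * b k.
Proof.
elim: n => [|n IHn]; first by rewrite series_ord /= !big_ord0.
rewrite seriesSr IHn /conv 2!big_ord_recr /= subnn subSnn addrA -big_split /=.
rewrite [series a 1%N]series_ord /= big_ord1; congr (_ + _).
by apply: eq_bigr => k _; rewrite subSn 1?ltnW// seriesSr mulrDl.
Qed.

Section CauchyProduct.
Variable R : realType.
Implicit Types a b : R^nat.

(** The square of side n lies in the triangle i + k < 2n, and the remaining terms are
    nonnegative. *)
Lemma series_conv_ge (a b : R^nat) (n : nat) :
  (forall k, 0 <= a k) -> (forall k, 0 <= b k) ->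
  series a n * series b n <= series (conv a b) (n + n)%N.
Proof.
move=> a0 b0; rewrite series_conv big_split_ord /= -[leLHS]addr0 lerD //.
  rewrite [series b n]series_ord /= mulr_sumr; apply: ler_sum => k _.
  rewrite ler_wpM2r //; apply: nondecreasing_series => //.
  by rewrite -addnBA ?leq_addr// ltnW.
apply: sumr_ge0 => k _; rewrite mulr_ge0 // series_ord.
exact: sumr_ge0.
Qed.

(** The left side sums the terms in the square but outside the triangle; the triangle inequality on
    that region yields the same difference for absolute values. *)
Lemma norm_series_conv_sub (a b : R^nat) (n : nat) :
  `|series a n * series b n - series (conv a b) n| <=
  series (fun k => `|a k|) n * series (fun k => `|b k|) n
  - series (conv (fun k => `|a k|) (fun k => `|b k|)) n.
Proof.
rewrite !series_conv [series b n]series_ord [series (fun k => `|b k|) n]series_ord /=.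
rewrite !mulr_sumr -!sumrB; apply: le_trans (ler_norm_sum _ _ _) _.
apply: ler_sum => k _; rewrite -!mulrBl normrM ler_wpM2r //.
rewrite !sub_series leq_subr; exact: ler_norm_sum.
Qed.

Lemma cvg_series_conv_ge0 (a b : R^nat) (la lb : R) :
  (forall k, 0 <= a k) -> (forall k, 0 <= b k) ->
  series a @ \oo --> la -> series b @ \oo --> lb ->
  series (conv a b) @ \oo --> la * lb.
Proof.
move=> a0 b0 sa sb.
have c0 k : 0 <= conv a b k by apply: sumr_ge0 => i _; rewrite mulr_ge0.
have sab : (series a \* series b) @ \oo --> la * lb by exact: cvgM.
have nda : nondecreasing_seq (series a) by exact: nondecreasing_series.
have ndb : nondecreasing_seq (series b) by exact: nondecreasing_series.
have ndc : nondecreasing_seq (series (conv a b)).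
  exact: nondecreasing_series.
have le_ab n : series (conv a b) n <= series a n * series b n.
  rewrite series_conv [series b n]series_ord mulr_sumr; apply: ler_sum => k _.
  by rewrite ler_wpM2r // nda // leq_subr.
have sa0 n : 0 <= series a n by rewrite series_ord; apply: sumr_ge0.
have sb0 n : 0 <= series b n by rewrite series_ord; apply: sumr_ge0.
(* The triangle lies in the square, so these nondecreasing partial sums are bounded by [la * lb].
   The limit is then squeezed: triangle n <= square n <= triangle 2n. *)
have cc : cvgn (series (conv a b)).
  apply: nondecreasing_is_cvgn => //; exists (la * lb) => _ [n _ <-].
  apply: le_trans (le_ab n) _; apply: ler_pM => //.
    by rewrite -(cvg_lim _ sa)//; apply: nondecreasing_cvgn_le => //; apply: cvgP sa.
  by rewrite -(cvg_lim _ sb)//; apply: nondecreasing_cvgn_le => //; apply: cvgP sb.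
suff -> : la * lb = limn (series (conv a b)) by [].
apply/eqP; rewrite eq_le; apply/andP; split.
  rewrite -(cvg_lim _ sab)//; apply: limr_le; first exact: cvgP sab.
  near=> n; apply: le_trans (series_conv_ge n a0 b0) _.
  exact: nondecreasing_cvgn_le.
rewrite -(cvg_lim _ sab)//; apply: ler_lim => //; first exact: cvgP sab.
by near=> n; apply: le_ab.
Unshelve. all: by end_near. Qed.

(** The gap between square and triangle is dominated by the gap for the absolute values, which tends
    to 0 by the nonnegative case. *)
Lemma cvg_series_conv (a b : R^nat) (la lb : R) :
  cvgn [normed series a] -> cvgn [normed series b] ->
  series a @ \oo --> la -> series b @ \oo --> lb ->
  series (conv a b) @ \oo --> la * lb.
Proof.
move=> na nb sa sb.
have nab : series (conv (fun k => `|a k|) (fun k => `|b k|)) @ \oo -->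
    limn [normed series a] * limn [normed series b].
  by apply: cvg_series_conv_ge0.
have sab : (series a \* series b) @ \oo --> la * lb by exact: cvgM.
apply: cvg_sub0 sab; apply/norm_cvg0P.
have e0 : ([normed series a] \* [normed series b]
     - series (conv (fun k => `|a k|) (fun k => `|b k|))) @ \oo --> (0 : R).
  rewrite -(subrr (limn [normed series a] * limn [normed series b])).
  by apply: cvgB => //; apply: cvgM.
apply: squeeze_cvgr (@cvg_cst _ _ _ _ _) e0; near=> n.
rewrite normr_ge0 /= distrC; exact: norm_series_conv_sub.
Unshelve. all: by end_near. Qed.

End CauchyProduct.

(** * Identity theorem for real power series *)

Section PowerSeries.
Variable R : realType.

(* If a_0, ..., a_(m-1) vanish, dividing by z ^+ m leaves a power series that is
   zero for small z != 0 and tends to a_m as z tends to 0. *)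
Lemma pseries_eq0 (a : R^nat) :
  (\forall z \near (0 : R), pseries a z @ \oo --> (0 : R)) -> forall n, a n = 0.
Proof.
move=> /nbhs_ballP[e /= e0 ball_e] n.
have {ball_e} cva z : `|z| < e -> pseries a z @ \oo --> (0 : R).
  by move=> ze; apply: ball_e; rewrite /ball /= sub0r normrN.
elim/ltn_ind: n => m IHm.
(* Two radii inside the ball: convergence at [z0] gives absolute convergence at the smaller [z1],
   hence a summable majorant. *)
pose z0 := e / 2; pose z1 := e / 4.
have z0e : `|z0| < e by rewrite gtr0_norm ?divr_gt0// ltr_pdivrMr// ltr_pMr// ltr1n.
have z10 : `|z1| < `|z0|.
  by rewrite !gtr0_norm ?divr_gt0// ltr_pM2l// ltf_pV2 ?posrE// ltr_nat.
have z1gt0 : 0 < z1 by rewrite divr_gt0.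
pose b i := a (i + m)%N.
have pb z n : pseries a z (n + m)%N = z ^+ m * pseries b z n.
  rewrite /pseries !series_ord /= addnC big_split_ord /= big1 ?add0r; last first.
    by move=> i _; rewrite IHm// mul0r.
  by rewrite mulr_sumr; apply: eq_bigr => i _; rewrite /b [(i + m)%N]addnC exprD mulrCA.
have cvb z : z != 0 -> `|z| < e -> pseries b z @ \oo --> (0 : R).
  move=> zn0 ze.
  have -> : pseries b z = (z ^+ m)^-1 *: (fun n => pseries a z (n + m)%N).
    by apply/funext => n; rewrite fctE pb /GRing.scale/= mulKf ?expf_neq0.
  rewrite -[0](scaler0 _ (z ^+ m)^-1); apply: cvgZl_tmp.
  by rewrite cvg_shiftn; apply: cva.
have nb : cvgn (pseries (fun i => `|b i|) z1).
  apply: (is_cvg_pseries_inside_norm _ z10).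
  by apply: cvgP (cvb _ _ _) => //; rewrite gt_eqF// divr_gt0.
(* For 0 < |z| < [z1], factoring one |z| out of the tail of [pseries b z] leaves terms bounded by
   [f], so the tail is O(|z|). *)
pose f i := `|b i.+1| * z1 ^+ i.
have cf : cvgn (series f).
  have : cvgn (series (fun i => `|b i.+1| * z1 ^+ i.+1)).
    have /cvg_ex[l cl] := nb; apply/cvg_ex; exists (l - `|b 0%N|).
    have -> : series (fun i => `|b i.+1| * z1 ^+ i.+1) =
        fun n => pseries (fun i => `|b i|) z1 n.+1 - `|b 0%N|.
      apply/funext => n; rewrite /pseries !series_ord /= big_ord_recl.
      by rewrite expr0 mulr1 addrC addKr.
    by apply: cvgB; [rewrite cvg_shiftS|exact: cvg_cst].
  move=> /(@is_cvg_seriesZ _ _ z1^-1).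
  suff -> : z1^-1 *: (fun i => `|b i.+1| * z1 ^+ i.+1) = f by [].
  apply/funext => i; rewrite /f fctE /GRing.scale/= exprS mulrCA.
  by rewrite [_^-1 * _]mulrA mulVf ?gt_eqF// mul1r.
have bnd (z : R) : 0 < `|z| < z1 -> forall i, `|b i.+1 * z ^+ i.+1| <= f i * `|z|.
  move=> /andP[zgt0 zz1] i; rewrite normrM normrX exprSr mulrA ler_wpM2r//.
  by rewrite ler_wpM2l// lerXn2r// ?nnegrE ?ltW.
have lim0 := @lim_cvg_to_0_linear _ _ (fun z i => b i.+1 * z ^+ i.+1) _ z1gt0 cf bnd.
(* For small nonzero z the full series sums to 0, so its tail sums to the constant [- b 0]; this
   constant must equal the limit 0 of the tail. *)
have: (fun _ : R => - b 0%N) @ 0^' --> (0 : R).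
  apply: (cvg_trans _ lim0); apply: near_eq_cvg; near=> z.
  have ze : `|z| < e by near: z; apply: dnbhs0_lt.
  have zn0 : z != 0 by near: z; apply: nbhs_dnbhs_neq.
  have -> : series (fun i => b i.+1 * z ^+ i.+1) = (fun n => pseries b z n.+1 - b 0%N).
    apply/funext => n; rewrite /pseries !series_ord /= big_ord_recl.
    by rewrite expr0 mulr1 addrC addKr.
  apply: cvg_lim => //; rewrite -[X in _ --> X]add0r; apply: cvgB; last exact: cvg_cst.
  by rewrite cvg_shiftS; apply: cvb.
move=> /(cvg_lim (@Rhausdorff R)); rewrite lim_cst// => /eqP.
by rewrite oppr_eq0 => /eqP.
Unshelve. all: by end_near. Qed.

End PowerSeries.

(** * Matrix series, exponential and real powers *)

Section MatrixSeries.
Variable R : realType.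

Lemma cvg_mxP (m n : nat) (u : nat -> 'M[R]_(m, n)) (l : 'M[R]_(m, n)) :
  u @ \oo --> l <-> forall i j, (fun k => u k i j) @ \oo --> l i j.
Proof.
split=> [ul i j|ul]; first exact: (cvg_comp _ _ ul (@coord_continuous R m n i j l)).
apply/cvg_ballP => e e0.
near=> k.
suff bl : forall ij : 'I_m * 'I_n, ball (l ij.1 ij.2) e (u k ij.1 ij.2).
  by split=> // i j; apply: (bl (i, j)).
(* There are finitely many entries, so one rank serves all of them. *)
near: k; apply: filter_forall => -[i j] /=.
exact: (cvg_ball (ul i j)).
Unshelve. all: by end_near. Qed.

Lemma series_mxE (m n : nat) (u : nat -> 'M[R]_(m, n)) i j :
  (fun k => series u k i j) = series (fun k => u k i j).
Proof. by apply/funext => k; rewrite !series_ord summxE. Qed.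

(** Each entry of the convolution is a finite sum of scalar Cauchy products, so absolute convergence
    is only asked entrywise. *)
Lemma mx_cvg_series_conv (n : nat) (U V : nat -> 'M[R]_n) (LU LV : 'M[R]_n) :
  (forall i j, cvgn [normed series (fun k => U k i j)]) ->
  (forall i j, cvgn [normed series (fun k => V k i j)]) ->
  series U @ \oo --> LU -> series V @ \oo --> LV ->
  series (conv U V) @ \oo --> LU * LV.
Proof.
move=> nU nV /cvg_mxP cU /cvg_mxP cV; apply/cvg_mxP => i j.
have -> : (fun k => series (conv U V) k i j) = (fun k =>
    \sum_l series (conv (fun p => U p i l) (fun p => V p l j)) k).
  rewrite series_mxE; apply/funext => k; rewrite series_ord.
  under [RHS]eq_bigr do rewrite series_ord.
  rewrite exchange_big; apply: eq_bigr => p _ /=.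
  rewrite /conv summxE exchange_big; apply: eq_bigr => q _ /=.
  by rewrite -mulmxE mxE.
rewrite -mulmxE mxE; apply: cvg_big; first exact: add_continuous.
move=> l _; apply: cvg_series_conv => //.
  by rewrite -series_mxE; apply: cU.
by rewrite -series_mxE; apply: cV.
Qed.

Definition expm_coeff (n : nat) (X : 'M[R]_n) (k : nat) : 'M[R]_n :=
  k`!%:R^-1 *: X ^+ k.

(** An entry of a product is a sum of n terms, so each further factor X multiplies the entry bound
    by at most n C. This dominates the matrix exponential by the scalar one. *)
Lemma norm_expm_coeff_le (n : nat) (X : 'M[R]_n) (C : R) k i j :
  (forall i j, `|X i j| <= C) ->
  `|expm_coeff X k i j| <= exp_coeff (n%:R * C) k.
Proof.
move=> XC; have C0 : 0 <= C by apply: le_trans (XC i j).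
rewrite /exp_coeff /= mxE normrM mulrC [`|_^-1|]ger0_norm ?invr_ge0// ler_wpM2r ?invr_ge0//.
elim: k i j => [|k IHk] i j.
  by rewrite expr0 /exp_coeff mxE; case: eqP; rewrite ?normr1 ?normr0.
rewrite exprS -mulmxE mxE; apply: le_trans (ler_norm_sum _ _ _) _.
apply: le_trans (ler_sum _ (G := fun=> C * (n%:R * C) ^+ k) _) _.
  by move=> l _; rewrite normrM ler_pM.
by rewrite sumr_const card_ord exprS -mulrA [leRHS]mulr_natl.
Qed.

Lemma cvg_normed_expm_coeff (n : nat) (X : 'M[R]_n) i j :
  cvgn [normed series (fun k => expm_coeff X k i j)].
Proof.
pose C := \sum_i \sum_j `|X i j|.
have XC i' j' : `|X i' j'| <= C.
  rewrite /C (bigD1 i') //= (bigD1 j') //= -addrA lerDl addr_ge0 //.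
    exact: sumr_ge0.
  by apply: sumr_ge0 => p _; apply: sumr_ge0.
apply: series_le_cvg (is_cvg_series_exp_coeff (n%:R * C)) => k //=.
  by apply: exp_coeff_ge0; rewrite mulr_ge0// (le_trans _ (XC i j)).
exact: norm_expm_coeff_le.
Qed.

Lemma cvg_series_expm (n : nat) (X : 'M[R]_n) :
  series (expm_coeff X) @ \oo --> expm X.
Proof.
apply/cvg_ex; exists (\matrix_(i, j) limn (series (fun k => expm_coeff X k i j))).
apply/cvg_mxP => i j; rewrite mxE; rewrite series_mxE.
apply: normed_cvg; exact: cvg_normed_expm_coeff.
Qed.

(** The binomial theorem for commuting matrices, with 'C(k, i) / k! = 1 / (i! (k - i)!). *)
Lemma conv_expm_coeff (n : nat) (X Y : 'M[R]_n) : GRing.comm X Y ->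
  conv (expm_coeff X) (expm_coeff Y) = expm_coeff (X + Y).
Proof.
move=> XY; apply/funext => k; rewrite /conv /expm_coeff exprDn_comm//.
rewrite scaler_sumr; apply: eq_bigr => i _.
rewrite -mulmxE -scalemxAl -scalemxAr; set Z := X ^+ _ *m _.
apply/matrixP => p q; rewrite !mxE mulmxnE -[Z p q *+ _]mulr_natl !mulrA.
congr (_ * _); last by rewrite mxE.
have ik : (i <= k)%N by rewrite -ltnS.
have C0 : 'C(k, i)%:R != 0 :> R by rewrite pnatr_eq0 -lt0n bin_gt0.
by rewrite -(bin_fact ik) !natrM !invfM mulrAC mulVf// mul1r mulrC.
Qed.

Lemma expmD (n : nat) (X Y : 'M[R]_n) : GRing.comm X Y ->
  expm (X + Y) = expm X * expm Y.
Proof.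
move=> XY; apply: (cvg_lim (@norm_hausdorff _ _)).
rewrite -[X in series X](conv_expm_coeff XY); apply: mx_cvg_series_conv.
- exact: cvg_normed_expm_coeff.
- exact: cvg_normed_expm_coeff.
- exact: cvg_series_expm.
- exact: cvg_series_expm.
Qed.

(* This holds whatever matrix [logm M] is, so neither the existence nor the
   uniqueness of the principal logarithm is needed. *)
Lemma powmD (n : nat) (M : 'M[R]_n) (s t : R) :
  powm M (s + t) = powm M s * powm M t.
Proof.
rewrite /powm scalerDl expmD//.
by rewrite /GRing.comm -!mulmxE -!scalemxAl -!scalemxAr !scalerA mulrC.
Qed.

End MatrixSeries.

(** * Uniqueness and semigroup law of the convolution quadrature weights *)

Section Semigroup.
Variables (R : realType) (r : nat) (A : 'M[R]_r) (b : 'rV[R]_r) (h : R).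

Lemma cq_weights_entry (theta : R) (V : nat -> 'M[R]_r) :
  is_cq_weights A b h theta V ->
  \forall z \near (0 : R), forall i j, pseries (fun n => V n i j) z @ \oo -->
    powm (h^-1 *: rk_gamma A b z) theta i j.
Proof.
apply: filterS => z /cvg_mxP cV i j; move: (cV i j).
rewrite series_mxE.
suff -> : series (fun n => (z ^+ n *: V n) i j) = pseries (fun n => V n i j) z by [].
by congr series; apply/funext => n; rewrite mxE mulrC.
Qed.

(** Entrywise, the difference of the two weight sequences generates a power series summing to 0 near
    0. *)
Lemma is_cq_weights_unique (theta : R) (V W : nat -> 'M[R]_r) :
  is_cq_weights A b h theta V -> is_cq_weights A b h theta W -> V = W.
Proof.
move=> /cq_weights_entry hV /cq_weights_entry hW.
apply/funext => n; apply/matrixP => i j; apply/eqP; rewrite -subr_eq0; apply/eqP.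
apply: (@pseries_eq0 _ (fun n => V n i j - W n i j)).
near=> z.
have -> : pseries (fun n => V n i j - W n i j) z =
    pseries (fun n => V n i j) z - pseries (fun n => W n i j) z.
  apply/funext => k; rewrite /pseries !fctE !series_ord -sumrB.
  by apply: eq_bigr => p _; rewrite /= mulrBl.
rewrite -(subrr (powm (h^-1 *: rk_gamma A b z) theta i j)).
apply: cvgB.
  by move: i j; near: z.
by move: i j; near: z.
Unshelve. all: by end_near. Qed.

Lemma cq_weights_normed (theta : R) (V : nat -> 'M[R]_r) :
  is_cq_weights A b h theta V ->
  \forall z \near (0 : R), forall i j,
    cvgn [normed series (fun n => (z ^+ n *: V n) i j)].
Proof.
move=> /cq_weights_entry/nbhs_ballP[e /= e0 ball_e].
have e2 : 0 < e / 2 by rewrite divr_gt0.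
near=> z => i j.
have ze : `|z| < `|e / 2|.
  rewrite (gtr0_norm e2); near: z; exact: (@nbhs0_lt R R).
have ce : cvgn (pseries (fun n => V n i j) (e / 2)).
  apply: cvgP (ball_e _ _ i j); rewrite /ball /= sub0r normrN gtr0_norm//.
  by rewrite ltr_pdivrMr// ltr_pMr// ltr1n.
(* The absolute convergence result is applied at the point |z|, so that its terms are the norms of
   the entries of [z ^+ n *: V n]. *)
rewrite -[`|z|]normr_id in ze.
have := is_cvg_pseries_inside_norm ce ze.
suff -> : pseries (fun n => `|V n i j|) `|z| =
    [normed series (fun n => (z ^+ n *: V n) i j)] by [].
by congr series; apply/funext => n; rewrite /= mxE normrM normrX mulrC.
Unshelve. all: by end_near. Qed.

(** Convolving weights multiplies their generating functions, and powers of the same matrix multiply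
    by adding exponents. *)
Lemma is_cq_weightsD (s t : R) (V W : nat -> 'M[R]_r) :
  is_cq_weights A b h s V -> is_cq_weights A b h t W ->
  is_cq_weights A b h (s + t) (conv V W).
Proof.
move=> hV hW; have nV := cq_weights_normed hV; have nW := cq_weights_normed hW.
rewrite /is_cq_weights; near=> z.
have -> : (fun n => z ^+ n *: conv V W n) =
    conv (fun n => z ^+ n *: V n) (fun n => z ^+ n *: W n).
  apply/funext => n; rewrite /conv scaler_sumr; apply: eq_bigr => k _.
  by rewrite -mulmxE -scalemxAl -scalemxAr scalerA -exprD subnK// -ltnS.
rewrite powmD; apply: mx_cvg_series_conv.
- by near: z.
- by near: z.
- by near: z.
- by near: z.
Unshelve. all: by end_near. Qed.

End Semigroup.

(** * The inner product on stage matrices *)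

Section Inner.
Variables (R : realType) (r d : nat).
Implicit Types X Y Z : 'M[R]_(r, d).

(** The trace form reduces bilinearity and the adjoint rule to linearity of the trace and rules for
    transposes. *)
Lemma innerE X Y : inner X Y = \tr (X^T *m Y).
Proof.
rewrite /inner exchange_big; apply: eq_bigr => j _ /=.
by rewrite mxE; apply: eq_bigr => i _; rewrite mxE.
Qed.

Lemma innerDl X Y Z : inner (X + Y) Z = inner X Z + inner Y Z.
Proof. by rewrite !innerE linearD mulmxDl linearD. Qed.

Lemma innerDr X Y Z : inner X (Y + Z) = inner X Y + inner X Z.
Proof. by rewrite !innerE mulmxDr linearD. Qed.

Lemma innerZl (a : R) X Y : inner (a *: X) Y = a * inner X Y.
Proof. by rewrite !innerE linearZ -scalemxAl linearZ. Qed.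

Lemma innerZr (a : R) X Y : inner X (a *: Y) = a * inner X Y.
Proof. by rewrite !innerE -scalemxAr linearZ. Qed.

Lemma innerBl X Y Z : inner (X - Y) Z = inner X Z - inner Y Z.
Proof. by rewrite -scaleN1r innerDl innerZl mulN1r. Qed.

Lemma inner0l X : inner 0 X = 0.
Proof. by rewrite -(scale0r 0) innerZl mul0r. Qed.

Lemma inner0r X : inner X 0 = 0.
Proof. by rewrite -(scale0r 0) innerZr mul0r. Qed.

Lemma inner_suml (I : Type) (s : seq I) (P : pred I) (F : I -> 'M[R]_(r, d)) Y :
  inner (\sum_(i <- s | P i) F i) Y = \sum_(i <- s | P i) inner (F i) Y.
Proof. exact: (big_morph _ (fun X Z => innerDl X Z Y) (inner0l Y)). Qed.

Lemma inner_sumr (I : Type) (s : seq I) (P : pred I) (F : I -> 'M[R]_(r, d)) X :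
  inner X (\sum_(i <- s | P i) F i) = \sum_(i <- s | P i) inner X (F i).
Proof. exact: (big_morph _ (innerDr X) (inner0r X)). Qed.

Lemma inner_trmx (M : 'M[R]_r) X Y : inner (M^T *m X) Y = inner X (M *m Y).
Proof. by rewrite !innerE trmx_mul trmxK mulmxA. Qed.

End Inner.

Lemma inner_rows (R : realType) (r d : nat) (X Y : 'M[R]_(r, d)) :
  inner X Y = \sum_i inner (row i X) (row i Y).
Proof.
apply: eq_bigr => i _; rewrite /inner big_ord1; apply: eq_bigr => j _.
by rewrite !mxE.
Qed.

(** * Composition and adjointness of the discrete fractional derivatives *)

Section FracDerivatives.
Variables (R : realType) (r d : nat).
Implicit Types (V W : nat -> 'M[R]_r) (f g : nat -> 'M[R]_(r, d)).

Lemma sum_ord_shift (M : nmodType) (k p : nat) (F : nat -> M) : (p <= k)%N ->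
  \sum_(n < k.+1 | (p <= n)%N) F n = \sum_(q < (k - p).+1) F (p + q)%N.
Proof.
move=> pk; transitivity (\sum_(p <= n < k.+1) F n).
  by rewrite big_geq_mkord.
rewrite -{1}[p]add0n big_addn subSn// big_mkord.
by apply: eq_bigr => q _; rewrite addnC.
Qed.

(** A range independent of k, with the bound moved to the predicate, allows double sums to be
    exchanged. *)
Lemma frac_minus_widen V f (k N : nat) : (k <= N)%N ->
  frac_minus V f k = \sum_(n < N.+1 | (n <= k)%N) V (k - n)%N *m f n.
Proof.
by move=> kN; rewrite /frac_minus (big_ord_widen N.+1 (fun n => V (k - n)%N *m f n)).
Qed.

Lemma frac_minusD V f g k :
  frac_minus V (fun n => f n + g n) k = frac_minus V f k + frac_minus V g k.
Proof. by rewrite -big_split; apply: eq_bigr => n _; rewrite mulmxDr. Qed.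

Lemma frac_minusZ V (a : R) f k :
  frac_minus V (fun n => a *: f n) k = a *: frac_minus V f k.
Proof. by rewrite scaler_sumr; apply: eq_bigr => n _; rewrite scalemxAr. Qed.

(** Associativity of convolution: in the sum over p <= n <= k, exchange the order and put n = p +
    q. *)
Lemma frac_minus_comp V W f k :
  frac_minus V (frac_minus W f) k = frac_minus (conv V W) f k.
Proof.
transitivity (\sum_(n < k.+1) \sum_(p < k.+1 | (p <= n)%N)
    V (k - n)%N *m W (n - p)%N *m f p).
  apply: eq_bigr => n _; rewrite (@frac_minus_widen W f n k) -1?ltnS//.
  by rewrite mulmx_sumr; apply: eq_bigr => p _; rewrite mulmxA.
rewrite (exchange_big_dep xpredT) //=; apply: eq_bigr => p _.
rewrite (sum_ord_shift (fun n => V (k - n)%N *m W (n - p)%N *m f p)) -1?ltnS//.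
rewrite /conv mulmx_suml; apply: eq_bigr => q _.
by rewrite subnDA addKn.
Qed.

(** Discrete fractional integration by parts: both sides are the sum over k <= m <= N of the
    pairings of [f m] with [V (m - k) *m g k]. *)
Lemma inner_frac_plus V f g (N : nat) :
  \sum_(k < N.+1) inner (frac_plus V N f k) (g k) =
  \sum_(k < N.+1) inner (f k) (frac_minus V g k).
Proof.
transitivity (\sum_(k < N.+1) \sum_(m < N.+1 | (k <= m)%N)
    inner (f m) (V (m - k)%N *m g k)).
  apply: eq_bigr => k _.
  rewrite (sum_ord_shift (fun m => inner (f m) (V (m - k)%N *m g k))) -1?ltnS//.
  by rewrite inner_suml; apply: eq_bigr => n _; rewrite inner_trmx addKn.
rewrite (exchange_big_dep xpredT) //=; apply: eq_bigr => m _.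
by rewrite (@frac_minus_widen V g m N) -1?ltnS// inner_sumr.
Qed.

Lemma inner_weighted (b : 'rV[R]_r) f g k :
  inner (weighted b f k) (g k) = inner (weighted b g k) (f k).
Proof.
rewrite /weighted -[X in X *m f k]tr_diag_mx inner_trmx.
by rewrite innerE -mxtrace_tr trmx_mul trmxK -innerE.
Qed.

Lemma inner_frac_semigroup V f g (N : nat) :
  \sum_(k < N.+1) inner (frac_plus V N f k) (frac_minus V g k) =
  \sum_(k < N.+1) inner (f k) (frac_minus (conv V V) g k).
Proof.
rewrite inner_frac_plus; apply: eq_bigr => k _.
by rewrite frac_minus_comp.
Qed.

End FracDerivatives.

(** * Gradients and differentiability of the discrete Lagrangian *)

Section Derivatives.
Variables (R : realType).

Lemma is_derive_line (V : normedModType R) (F : V -> R) (X v : V) :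
  differentiable F X ->
  is_derive (0 : R) (1 : R) (fun eps => F (X + eps *: v)) ('D_v F X).
Proof.
move=> dF; have := diff_derivable (v := v) dF; rewrite /derivable /derive.
(* The form [h * 1 + 0] is the displacement in the difference quotient of a function of one real
   variable, at 0 in direction 1. *)
have -> : (fun h : R => h^-1 *: (F (h *: v + X) - F X)) =
    (fun h : R => h^-1 *: (F (X + (h * 1 + 0) *: v) - F (X + 0 *: v))).
  apply/funext => h /=; rewrite scale0r addr0 [X + _]addrC addr0.
  by rewrite mulr1.
by split.
Qed.

(** The gradient for [inner]; its i-th row is [row_partial i F X], the D_i of the equations. *)
Definition row_gradient (r d : nat) (F : 'M[R]_(r, d) -> R) (X : 'M[R]_(r, d)) :
    'M[R]_(r, d) :=
  \matrix_(i, j) 'D_(delta_mx i j) F X.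

Lemma derive_row_gradient (r d : nat) (F : 'M[R]_(r, d) -> R) X v :
  differentiable F X -> 'D_v F X = inner (row_gradient F X) v.
Proof.
move=> dF; rewrite deriveE// [in LHS](matrix_sum_delta v) linear_sum.
apply: eq_bigr => i _; rewrite linear_sum; apply: eq_bigr => j _.
by rewrite linearZ mxE deriveE// mulrC.
Qed.

Lemma differentiable_row (r d : nat) (i : 'I_r) (X : 'M[R]_(r, d)) :
  differentiable (row i : 'M[R]_(r, d) -> 'rV[R]_d) X.
Proof.
have -> : row i = \sum_(j < d) (fun Y : 'M[R]_(r, d) => Y i j *: delta_mx 0 j : 'rV[R]_d).
  apply/funext => Y; rewrite fct_sumE [LHS]row_sum_delta.
  by apply: eq_bigr => j _; rewrite mxE.
apply: differentiable_sum => j; apply: differentiableZl.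
exact: differentiable_coord.
Qed.

Lemma differentiable_row_comb (r d : nat) (a : 'I_r -> R) (X : 'M[R]_(r, d)) :
  differentiable (fun Y : 'M[R]_(r, d) => \sum_i a i *: row i Y) X.
Proof.
have -> : (fun Y : 'M[R]_(r, d) => \sum_i a i *: row i Y) =
    \sum_i (fun Y : 'M[R]_(r, d) => a i *: row i Y).
  by apply/funext => Y; rewrite fct_sumE.
apply: differentiable_sum => i; apply: differentiableZ.
exact: differentiable_row.
Qed.

(** Shows that the velocity, like the position, is a linear combination of the rows of X with
    coefficients independent of X, hence differentiable in X. *)
Lemma derive1_x_dis (d r : nat) (c : 'rV[R]_r) (h : R) (k : nat)
    (X : 'M[R]_(r, d)) (t : R) :
  derive1 (x_dis c h k X) t = \sum_nu
    ((lagrange_pol c nu)^`()%R.[(t - k%:R * h) / h] / h) *: row nu X.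
Proof.
(* The change of variable (t - t_k) / h is absorbed into the polynomial, so that the formal
   derivative applies. *)
pose q nu := lagrange_pol c nu \Po (h^-1 *: ('X - (k%:R * h)%:P)).
have qE nu u : (q nu).[u] = (lagrange_pol c nu).[(u - k%:R * h) / h].
  by rewrite horner_comp !hornerE mulrC.
have dq nu : differentiable (horner (q nu)) t.
  exact/derivable1_diffP/derivable_horner.
have -> : x_dis c h k X = \sum_nu (fun u => (q nu).[u] *: row nu X).
  by apply/funext => u; rewrite fct_sumE; apply: eq_bigr => nu _; rewrite qE.
rewrite derive1E derive_sum => [|nu]; last first.
  exact/diff_derivable/differentiableZl.
apply: eq_bigr => nu _; rewrite deriveE; last exact: differentiableZl.
rewrite diffZl//; congr (_ *: _).
rewrite -derive1E' // -derivE deriv_comp hornerM horner_comp.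
by rewrite derivZ derivXsubC !hornerE [h^-1 * _]mulrC; apply: mulr1.
Qed.

Lemma differentiable_L_dis (d r : nat) (b c : 'rV[R]_r) (h : R)
    (L : 'rV[R]_d * 'rV[R]_d -> R) (k : nat) (X : 'M[R]_(r, d)) :
  (forall q, differentiable L q) -> differentiable (L_dis b c h L k) X.
Proof.
move=> dL; apply: differentiableZ.
have -> : (fun X => \sum_i b 0 i * L (x_dis c h k X (k%:R * h + c 0 i * h),
                        derive1 (x_dis c h k X) (k%:R * h + c 0 i * h))) =
   \sum_i (fun X => b 0 i *: L (x_dis c h k X (k%:R * h + c 0 i * h),
                        derive1 (x_dis c h k X) (k%:R * h + c 0 i * h))).
  by apply/funext => Y; rewrite fct_sumE.
apply: differentiable_sum => i; apply: differentiableZ.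
apply: (differentiable_comp (f := fun Y => (x_dis c h k Y (k%:R * h + c 0 i * h),
    derive1 (x_dis c h k Y) (k%:R * h + c 0 i * h)))) => //.
apply: differentiable_pair; first exact: differentiable_row_comb.
under eq_fun do rewrite derive1_x_dis.
exact: differentiable_row_comb.
Qed.

End Derivatives.

(** * Summation by parts against admissible variations *)

Section Variations.
Variables (R : realType) (d s N : nat).

(** With [s.+2] rows the first and last are distinct, so the two end contributions are separate. *)
Lemma inner_ends (G v : 'M[R]_(s.+2, d)) :
  (forall i : 'I_s.+2, (0 < i < s.+1)%N -> row i G = 0) ->
  inner G v = inner (row ord0 G) (row ord0 v)
              + inner (row ord_max G) (row ord_max v).
Proof.
move=> G0; rewrite inner_rows big_ord_recl big_ord_recr /=.
rewrite big1 ?add0r => [|i _]; last by rewrite G0 ?inner0l //= ltnS ltn_ord.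
by have -> : lift ord0 ord_max = ord_max :> 'I_s.+2 by apply/val_inj.
Qed.

Lemma sum_inner_admissible (G dx : nat -> 'M[R]_(s.+2, d)) : (0 < N)%N ->
  admissible_variation N dx ->
  (forall k, (1 <= k <= N.-1)%N ->
     row ord_max (G k.-1) + row ord0 (G k) = 0) ->
  (forall k (i : 'I_s.+2), (k <= N.-1)%N -> (0 < i < s.+1)%N ->
     row i (G k) = 0) ->
  \sum_(k < N) inner (G k) (dx k) = 0.
Proof.
case: N => // M _ [dxc dx0 dxM _ _] Gnode Ginner.
transitivity (\sum_(k < M.+1) inner (row ord0 (G k)) (row ord0 (dx k)) +
    \sum_(k < M.+1) inner (row ord_max (G k)) (row ord_max (dx k))).
  rewrite -big_split; apply: eq_bigr => k _; apply: inner_ends => i.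
  by apply: Ginner; rewrite -ltnS.
(* The first-row term at k = 0 and the last-row term at k = M = N - 1 vanish by the end conditions.
   What remains pairs the first row at k + 1 with the last row at k, where the variation takes the
   same value. *)
rewrite big_ord_recl dx0 inner0r add0r big_ord_recr /= dxM inner0r addr0.
rewrite -big_split big1 // => k _ /=.
have kM : (1 <= k.+1 <= M)%N by rewrite ltn_ord.
have /= dxk := dxc k.+1 (ltnW (ltn_ord k)).
rewrite /bump add1n dxk.
have /= Gk := Gnode k.+1 kM.
by rewrite -innerDl addrC Gk inner0l.
Qed.

End Variations.

(** * First variation of the discrete action *)

Lemma conv_cq_weights (R : realType) (r : nat) (A : 'M[R]_r) (b : 'rV[R]_r)
    (h alpha : R) (V W : nat -> 'M[R]_r) :
  is_cq_weights A b h alpha V -> is_cq_weights A b h (2 * alpha) W ->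
  conv V V = W.
Proof.
move=> hV; apply: is_cq_weights_unique.
by rewrite mulr_natl mulr2n; apply: is_cq_weightsD.
Qed.

Lemma is_derive_quadratic (R : realType) (a0 a1 a2 : R) :
  is_derive (0 : R) (1 : R) (fun eps => a0 + eps * a1 + eps ^+ 2 * a2) a1.
Proof.
pose p : {poly R} := a0%:P + 'X * a1%:P + 'X^2 * a2%:P.
have -> : (fun eps => a0 + eps * a1 + eps ^+ 2 * a2) = horner p.
  by apply/funext => e; rewrite /p !hornerE.
apply: is_derive_eq.
rewrite /p !(poly.derivE, hornerE); exact: etrans (addr0 _) (addr0 _).
Qed.

(** By bilinearity the fractional term is a quadratic polynomial in eps. Its linear coefficient
    [Q y dx + Q dx x] is brought to a pairing with [dx] by adjointness in the first summand and
    symmetry of the diagonal weights in the second. *)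
Lemma is_derive_inner_frac (R : realType) (r d N : nat) (b : 'rV[R]_r)
    (V : nat -> 'M[R]_r) (x y dx : nat -> 'M[R]_(r, d)) :
  is_derive (0 : R) (1 : R) (fun eps => \sum_(k < N.+1)
     inner (frac_plus V N (weighted b (fun k => y k + eps *: dx k)) k)
           (frac_minus V (fun k => x k + eps *: dx k) k))
   (\sum_(k < N.+1) inner (frac_plus (conv V V) N (weighted b y) k
       + weighted b (frac_minus (conv V V) x) k) (dx k)).
Proof.
set W := conv V V.
pose Q (f g : nat -> 'M[R]_(r, d)) := \sum_(k < N.+1) inner (weighted b f k) (frac_minus W g k).
have QDl (f f' g : nat -> 'M[R]_(r, d)) (e : R) : Q (fun k => f k + e *: f' k) g = Q f g + e * Q f' g.
  rewrite /Q mulr_sumr -big_split; apply: eq_bigr => k _ /=.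
  by rewrite /weighted mulmxDr -scalemxAr innerDl innerZl.
have QDr (f g g' : nat -> 'M[R]_(r, d)) (e : R) : Q f (fun k => g k + e *: g' k) = Q f g + e * Q f g'.
  rewrite /Q mulr_sumr -big_split; apply: eq_bigr => k _ /=.
  by rewrite frac_minusD frac_minusZ innerDr innerZr.
have -> : \sum_(k < N.+1) inner (frac_plus W N (weighted b y) k
    + weighted b (frac_minus W x) k) (dx k) = Q y dx + Q dx x.
  under eq_bigr do rewrite innerDl inner_weighted.
  by rewrite big_split inner_frac_plus.
have -> : (fun eps : R => \sum_(k < N.+1)
     inner (frac_plus V N (weighted b (fun k => y k + eps *: dx k)) k)
           (frac_minus V (fun k => x k + eps *: dx k) k)) =
   (fun eps => Q y x + eps * (Q y dx + Q dx x) + eps ^+ 2 * Q dx dx).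
  apply/funext => e; rewrite inner_frac_semigroup -/(Q _ _) QDl !QDr.
  by rewrite !mulrDr mulrA -expr2 !addrA.
exact: is_derive_quadratic.
Qed.

Lemma is_derive_action (R : realType) (d r N : nat) (h rho : R)
    (L : 'rV[R]_d * 'rV[R]_d -> R) (b c : 'rV[R]_r) (V : nat -> 'M[R]_r)
    (x y dx : nat -> 'M[R]_(r, d)) :
  (forall q, differentiable L q) -> dx N = 0 ->
  is_derive (0 : R) (1 : R)
    (fun eps : R => action b c h L N rho V
       (fun k => x k + eps *: dx k) (fun k => y k + eps *: dx k))
    (\sum_(k < N) inner (row_gradient (L_dis b c h L k) (x k)
         - (rho * h) *: weighted b (frac_minus (conv V V) x) k) (dx k)
     + \sum_(k < N) inner (row_gradient (L_dis b c h L k) (y k)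
         - (rho * h) *: frac_plus (conv V V) N (weighted b y) k) (dx k)).
Proof.
move=> dL dxN.
have dLk k X v : is_derive (0 : R) (1 : R)
    (fun eps => L_dis b c h L k (X + eps *: v))
    (inner (row_gradient (L_dis b c h L k) X) v).
  have dF := differentiable_L_dis b c h k X dL.
  rewrite -(derive_row_gradient v dF); exact: is_derive_line.
have dLs : is_derive (0 : R) (1 : R)
    (\sum_(k < N) ((fun eps => L_dis b c h L k (x k + eps *: dx k))
       + (fun eps => L_dis b c h L k (y k + eps *: dx k))))
    (\sum_(k < N) (inner (row_gradient (L_dis b c h L k) (x k)) (dx k)
       + inner (row_gradient (L_dis b c h L k) (y k)) (dx k))).
  apply: is_derive_sum => k; exact: is_deriveD.
have dQ := is_deriveZ (rho * h) (is_derive_inner_frac N b V x y dx).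
have := is_deriveB dLs dQ.
set F := (X in is_derive _ _ X _ -> _); set G := (X in _ -> is_derive _ _ X _).
have -> : F = G.
  apply/funext => e; rewrite /F /G /action !fctE; congr (_ - _).
  by rewrite fct_sumE.
move=> FG; apply: is_derive_eq.
(* The fractional sum runs to N but the Lagrangian sum only to N - 1; [dx N = 0] removes the extra
   term, and the two sums merge. *)
rewrite big_ord_recr /= dxN inner0r addr0 -big_split scaler_sumr -sumrB.
apply: eq_bigr => k _ /=.
rewrite !innerBl !innerZl innerDl scalerDr opprD.
by rewrite [X in _ + X = _]addrC addrACA.
Qed.

Lemma row_gradient_subZ (R : realType) (r d : nat) (F : 'M[R]_(r, d) -> R)
    (X Y : 'M[R]_(r, d)) (a : R) i :
  row i (row_gradient F X - a *: Y) = row_partial i F X - a *: row i Y.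
Proof. by apply/rowP => j; rewrite !mxE. Qed.

Lemma row_weighted (R : realType) (r d : nat) (b : 'rV[R]_r)
    (f : nat -> 'M[R]_(r, d)) k i :
  row i (weighted b f k) = b 0 i *: row i (f k).
Proof. by rewrite /weighted mul_diag_mx; apply/rowP => j; rewrite !mxE. Qed.

Theorem theorem4p2 (R : realType) (d N s : nat) (T h alpha rho : R)
  (L : 'rV[R]_d * 'rV[R]_d -> R)
  (A : 'M[R]_s.+1) (b c : 'rV[R]_s.+1) (V : R -> nat -> 'M[R]_s.+1)
  (x y : nat -> 'M[R]_(s.+1, d))
  (hd : (1 <= d)%N) (hN : (1 <= N)%N) (hs : (1 <= s)%N)
  (hT : 0 < T) (hh : h = T / N%:R) (halpha : 0 < alpha) (hrho : 0 < rho)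
  (hL : is_Cn 2 L)
  (hRK : lobattoIIIC A b c)
  (hV : forall theta : R, 0 < theta -> is_cq_weights A b h theta (V theta))
  (hx : continuous_series N x) (hy : continuous_series N y)
  (hxN : forall i : 'I_s.+1, (0 < i)%N -> row i (x N) = 0)
  (hyN : forall i : 'I_s.+1, (0 < i)%N -> row i (y N) = 0)
  (eq_x_node : forall k : nat, (1 <= k <= N.-1)%N ->
     row_partial ord_max (L_dis b c h L k.-1) (x k.-1)
     + row_partial ord0 (L_dis b c h L k) (x k)
     - (rho * h) *:
         (b 0 ord0 *: row ord0 (frac_minus (V (2 * alpha)) x k)
          + b 0 ord_max *: row ord_max (frac_minus (V (2 * alpha)) x k.-1))
     = 0)
  (eq_x_inner : forall (k : nat) (i : 'I_s.+1),
     (k <= N.-1)%N -> (0 < i < s)%N ->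
     row_partial i (L_dis b c h L k) (x k)
     - (rho * h * b 0 i) *: row i (frac_minus (V (2 * alpha)) x k) = 0)
  (eq_y_node : forall k : nat, (1 <= k <= N.-1)%N ->
     row_partial ord_max (L_dis b c h L k.-1) (y k.-1)
     + row_partial ord0 (L_dis b c h L k) (y k)
     - (rho * h) *:
         (row ord0 (frac_plus (V (2 * alpha)) N (weighted b y) k)
          + row ord_max (frac_plus (V (2 * alpha)) N (weighted b y) k.-1))
     = 0)
  (eq_y_inner : forall (k : nat) (i : 'I_s.+1),
     (k <= N.-1)%N -> (0 < i < s)%N ->
     row_partial i (L_dis b c h L k) (y k)
     - (rho * h) *: row i (frac_plus (V (2 * alpha)) N (weighted b y) k) = 0) :
  forall dx : nat -> 'M[R]_(s.+1, d), admissible_variation N dx ->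
    is_derive (0 : R) (1 : R)
      (fun eps : R =>
         action b c h L N rho (V alpha)
           (fun k => x k + eps *: dx k) (fun k => y k + eps *: dx k))
      (0 : R).
Proof.
move=> dx adm; have [_ _ _ _ dxN] := adm.
have alpha2 : conv (V alpha) (V alpha) = V (2 * alpha).
  by apply: conv_cq_weights (hV _ halpha) (hV _ _); rewrite mulr_gt0.
have := is_derive_action h rho b c (V alpha) x y hL.1 dxN; rewrite alpha2.
(* Since s >= 1, it is replaced by a successor, as [sum_inner_admissible] requires; everything whose
   type depends on s is generalized first. *)
case: s hs b c V x y eq_x_node eq_x_inner eq_y_node eq_y_inner dx adm
  {A hV hRK hx hy hxN hyN alpha2 dxN}
  => // {}s _ b c V x y eq_x_node eq_x_inner eq_y_node eq_y_inner dx adm.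
(* [Gx] and [Gy] collect the residuals of the x and y equations: inner rows give the stage
   equations, and last row at k - 1 plus first row at k gives the node equation. Each family makes
   its own sum vanish. *)
pose Gx k := row_gradient (L_dis b c h L k) (x k)
  - (rho * h) *: weighted b (frac_minus (V (2 * alpha)) x) k.
pose Gy k := row_gradient (L_dis b c h L k) (y k)
  - (rho * h) *: frac_plus (V (2 * alpha)) N (weighted b y) k.
have sGx : \sum_(k < N) inner (Gx k) (dx k) = 0.
  apply: sum_inner_admissible => // [k kN|k i kN i0].
    rewrite -[RHS](eq_x_node k kN) !row_gradient_subZ !row_weighted.
    by rewrite scalerDr opprD addrACA [X in _ + X = _]addrC.
  rewrite -[RHS](eq_x_inner k i kN i0).
  by rewrite row_gradient_subZ row_weighted scalerA.
have sGy : \sum_(k < N) inner (Gy k) (dx k) = 0.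
  apply: sum_inner_admissible => // [k kN|k i kN i0].
    rewrite -[RHS](eq_y_node k kN) !row_gradient_subZ.
    by rewrite scalerDr opprD addrACA [X in _ + X = _]addrC.
  rewrite -[RHS](eq_y_inner k i kN i0); exact: row_gradient_subZ.
by rewrite sGx sGy addr0.
Qed.
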